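(* Let $n$ be an even positive integer. For nonnegative integers $k$, define $$F_n(k) := \sum_{j=1}^n \left((-1)^j\,2\cos\left(\frac{j\pi}{2n+1}\right)\right)^k,$$ and let $$u_n := \prod_{j=1}^n \left(\tan\left(\frac{(2j-1)\pi}{8n+4}\right)\right)^{(2j-1)(-1)^{j+1}}.$$ Then $u_n$ is a unit algebraic integer, and Catalan's constant $G$ has the series acceleration formula $$G = \left(\frac{\pi}{4n}\right)\log u_n - \left(\frac{2n+1}{4n}\right)\sum_{k=0}^\infty \frac{F_n(2k+1)}{(2k+1)^2\binom{2k}{k}}.$$
   Context: Catalan's constant is $G := \sum_{k=0}^\infty \frac{(-1)^k}{(2k+1)^2}$. A unit algebraic integer (algebraic unit) is an invertible algebraic integer, i.e. a nonzero algebraic integer whose multiplicative inverse is also an algebraic integer. *)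

(* Defs.v *)
From HB Require Import structures.
From mathcomp Require Import all_boot all_order all_algebra.
From mathcomp Require Import all_classical all_reals all_analysis.

Set Implicit Arguments.
Unset Strict Implicit.
Unset Printing Implicit Defensive.

Import Order.TTheory GRing.Theory Num.Theory.
Import numFieldNormedType.Exports.

Local Open Scope classical_set_scope.
Local Open Scope ring_scope.

Definition catalan_constant (R : realType) : R :=
  limn (series (fun k : nat => (-1) ^+ k / (2 * k + 1)%:R ^+ 2 : R)).

Definition algebraic_integer (R : realType) (x : R) : Prop :=
  integralOver (intr : int -> R) x.

(* The condition x != 0 is not redundant, because 0^-1 = 0. *)
Definition algebraic_unit (R : realType) (x : R) : Prop :=
  [/\ x != 0, algebraic_integer x & algebraic_integer x^-1].

Definition F (R : realType) (n k : nat) : R :=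
  \sum_(1 <= j < n.+1)
    ((-1) ^+ j * 2 * cos (j%:R * pi / (2 * n + 1)%:R)) ^+ k.

(* The exponent (2j-1)(-1)^(j+1) is an integer of either sign. The truncated
   subtraction (2 * j - 1)%N is exact since j >= 1. *)
Definition u (R : realType) (n : nat) : R :=
  \prod_(1 <= j < n.+1)
    tan ((2 * j - 1)%:R * pi / (8 * n + 4)%:R)
      ^ ((2 * j - 1)%:Z * (-1) ^+ j.+1).

Definition acceleration_term (R : realType) (n k : nat) : R :=
  F R n (2 * k + 1) / ((2 * k + 1)%:R ^+ 2 * 'C(2 * k, k)%:R).

(* Main.v *)
Require Import Defs.
From mathcomp Require Import all_boot all_order all_algebra.
From mathcomp Require Import all_classical all_reals all_analysis.
From mathcomp Require Import ring lra zify.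

Import Order.TTheory GRing.Theory Num.Theory.
Import numFieldNormedType.Exports.

Local Open Scope classical_set_scope.
Local Open Scope ring_scope.

(** For 0 < x < pi/2 the two functions
      A(x) = sum_k (2 sin x)^(2k+1) / ((2k+1)^2 C(2k,k))   and
      B(x) = 2 x log tan(x/2) + 4 sum_k sin((2k+1)x) / (2k+1)^2
    have the same derivative 2x / sin x: for A because
    cos x sum_k 4^k sin^(2k+1) x / ((2k+1) C(2k,k)) is the expansion of x in
    terms of sin x (the series of arcsin y / sqrt(1-y^2)), for B because of the
    Fourier expansion log tan(x/2) = - 2 sum_k cos((2k+1)x) / (2k+1).  Hence
    A - B is constant.  Put N = 2n+1 and x_i = (2i+1) pi / (2N) for i < n, and
    take the alternating sum of A - B over these nodes.

    - The unknown constant disappears: as n is even, there are as many plus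
      signs as minus signs.  This is why the constant is never computed.
    - (-1)^(n-i) 2 cos((n-i) pi / N) = (-1)^i 2 sin x_i, so that the values of
      A add up to the series to be evaluated.
    - The terms 2 x_i log tan(x_i/2) add up to (pi/N) log u_n.
    - The inner sum over i of (-1)^i sin((2k+1) x_i) is -(-1)^k / 2, except that
      it is n (-1)^k when N divides 2k+1.  With these weights the sine series
      becomes -G/2 + (N/2) G/N^2 = - n G / N.

    No series is differentiated term by term.  The difference A - B is
    truncated at K terms (defect), and its derivative consists of two truncation
    errors whose own derivatives have closed forms: for A they telescope
    (is_derive_arcsin_sum), and for B they are given by the sum of the sines of
    odd multiples of x (sum_sin_odd).  The errors are therefore uniformly small
    on compact parts of (0, pi/2), and the mean value theorem shows that the
    truncated difference varies by o(1) between the nodes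
    (alternating_defect_cvg0).
    Taking K = N L makes the sum over k consist of complete periods of the
    weights above (sum_node_sin_sum).

    That u_n is a unit: if cos(m t) = 0, the expansion of cos(m t) / sin(t)^m
    is a monic integer polynomial in cot t, so cot t is an algebraic integer.
    Each angle x_i / 2 has this property with m = 2N, and so does its complement
    pi/2 - x_i/2, whose cotangent is tan(x_i/2); thus tan(x_i/2) and its inverse
    are both algebraic integers. *)

(** * Derivation rules and the mean value bound *)

Section Derivation.
Context {R : realType}.
Implicit Types (f g : R -> R) (x a b : R).

(** These rules are stated for explicitly abstracted functions, the form in
    which all the functions below are written. *)
Lemma is_deriveD_fun f g x a b :
  is_derive x 1 f a -> is_derive x 1 g b ->
  is_derive x 1 (fun y => f y + g y) (a + b).
Proof. by move=> df dg; apply: is_deriveD. Qed.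

Lemma is_deriveB_fun f g x a b :
  is_derive x 1 f a -> is_derive x 1 g b ->
  is_derive x 1 (fun y => f y - g y) (a - b).
Proof. by move=> df dg; apply: is_deriveB. Qed.

Lemma is_deriveM_fun f g x a b :
  is_derive x 1 f a -> is_derive x 1 g b ->
  is_derive x 1 (fun y => f y * g y) (a * g x + f x * b).
Proof.
move=> df dg; apply: is_derive_eq (is_deriveM df dg) _.
by rewrite /GRing.scale/= addrC (mulrC a).
Qed.

Lemma is_derive_scale_fun c f x a :
  is_derive x 1 f a -> is_derive x 1 (fun y => c * f y) (c * a).
Proof.
move=> df; apply: is_derive_eq (is_deriveM_fun (cst c) f x 0 a _ df) _.
by rewrite mul0r add0r.
Qed.

Lemma is_deriveX_fun f x a n :
  is_derive x 1 f a ->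
  is_derive x 1 (fun y => f y ^+ n) (n%:R * f x ^+ n.-1 * a).
Proof.
move=> df; have -> : (fun y => f y ^+ n) = f ^+ n.
  by apply/funext => y; rewrite fctE.
exact: is_deriveX.
Qed.

Lemma is_deriveV_fun f x a :
  f x != 0 -> is_derive x 1 f a ->
  is_derive x 1 (fun y => (f y)^-1) (- a / f x ^+ 2).
Proof.
move=> fx0 df; apply: is_derive_eq (is_deriveV fx0 df) _.
by rewrite /GRing.scale/= !mulNr mulrC.
Qed.

Lemma is_derive_comp_fun f g x a b :
  is_derive (g x) 1 f a -> is_derive x 1 g b ->
  is_derive x 1 (fun y => f (g y)) (a * b).
Proof. exact: is_derive1_comp. Qed.

Lemma is_derive_sum_fun (f : nat -> R -> R) (df : nat -> R) x K :
  (forall k, is_derive x 1 (f k) (df k)) ->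
  is_derive x 1 (fun y => \sum_(0 <= k < K) f k y) (\sum_(0 <= k < K) df k).
Proof.
move=> dfE; elim: K => [|K IH].
  rewrite big_nil (_ : (fun _ => _) = cst 0); first exact: is_derive_cst.
  by apply/funext => y; rewrite big_nil.
rewrite big_nat_recr//= (_ : (fun _ => _) =
  (fun y => \sum_(0 <= k < K) f k y + f K y)); last first.
  by apply/funext => y; rewrite big_nat_recr.
exact: is_deriveD_fun.
Qed.

Lemma is_derive_mulc c x : is_derive x 1 (fun y : R => c * y) c.
Proof.
by apply: is_derive_eq (is_derive_scale_fun c id x 1 _) _; rewrite mulr1.
Qed.

Lemma mean_value_bound f (df : R -> R) a b M : a <= b ->
  (forall x, a <= x <= b -> is_derive x 1 f (df x)) ->
  (forall x, a <= x <= b -> `|df x| <= M) ->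
  `|f b - f a| <= M * (b - a).
Proof.
move=> ab fd dfM.
have [||c] := @MVT_segment R f df a b ab.
- by move=> x; rewrite in_itv/= => /andP[/ltW ax /ltW xb]; apply: fd; rewrite ax.
- apply: derivable_within_continuous => x; rewrite in_itv/= => /fd h.
  exact: ex_derive.
- rewrite in_itv/= => /dfM dcM ->; rewrite normrM (ger0_norm (_ : 0 <= b - a)).
    by rewrite ler_wpM2r// subr_ge0.
  by rewrite subr_ge0.
Qed.

End Derivation.

(** * Partial sums of the arcsine series *)

Section Arcsin.
Context {R : realType}.

(** The Taylor coefficients of arcsin y / sqrt(1 - y^2) at odd powers of y. *)
Definition arcsin_coef (k : nat) : R :=
  4 ^+ k / ((2 * k + 1)%:R * 'C(2 * k, k)%:R).

Lemma natr2D (k m : nat) : (2 * k + m)%:R = 2 * k%:R + m%:R :> R.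
Proof. by rewrite natrD natrM. Qed.

Lemma central_bin_gt0 k : 0 < 'C(2 * k, k)%:R :> R.
Proof. by rewrite ltr0n bin_gt0 mul2n -addnn leq_addr. Qed.

Lemma central_bin_rec k :
  (k.+1 * 'C(2 * k.+1, k.+1) = 2 * (2 * k + 1) * 'C(2 * k, k))%N.
Proof.
have h1 := mul_bin_diag (2 * k + 2) k.
have h2 := mul_bin_diag (2 * k + 1) k.
have h3 := @bin_sub (2 * k + 1) k.
have e1 : (2 * k.+1 = 2 * k + 2)%N by lia.
have e2 : ((2 * k + 2).-1 = 2 * k + 1)%N by lia.
have e3 : ((2 * k + 1).-1 = 2 * k)%N by lia.
have e4 : (2 * k + 1 - k = k.+1)%N by lia.
rewrite e2 in h1; rewrite e3 in h2; rewrite e4 in h3.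
rewrite e1 -h1 -h3 ?mulnA; last by lia.
rewrite (_ : (2 * k + 2 = 2 * k.+1)%N); last by lia.
by rewrite -[in LHS]mulnA -h2 mulnA.
Qed.

(** This recurrence expresses the differential equation of
    arcsin y / sqrt(1 - y^2); it is what makes the derivative in
    is_derive_arcsin_sum telescope. *)
Lemma arcsin_coef_rec k :
  (2 * k + 3)%:R * arcsin_coef k.+1 = (2 * k + 2)%:R * arcsin_coef k.
Proof.
have := central_bin_gt0 k; have := central_bin_gt0 k.+1.
have := central_bin_rec k; rewrite /arcsin_coef.
rewrite (_ : (2 * k.+1 + 1 = 2 * k + 3)%N); last by lia.
move: 'C(_, _) 'C(_, _) => c d E d0 c0.
have {}E : (k.+1 * d)%:R = (2 * (2 * k + 1) * c)%:R :> R by rewrite E.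
rewrite !natrM natr2D -(natr1 k) in E; rewrite !natr2D.
have k0 : 0 <= k%:R :> R by [].
have -> : d%:R = 2 * (2 * k%:R + 1) * c%:R / (k%:R + 1) :> R.
  by apply: (canRL (mulfK _)); [lra | move: E; lra].
by rewrite exprS; field; lra.
Qed.

Lemma arcsin_coef_ge0 k : 0 <= arcsin_coef k.
Proof. by rewrite divr_ge0// mulr_ge0// ltW// central_bin_gt0. Qed.

Lemma arcsin_coef_le1 k : arcsin_coef k <= 1.
Proof.
elim: k => [|k IH]; first by rewrite /arcsin_coef bin0 expr0 !mulr1 divr1.
have h := arcsin_coef_rec k; have h0 := arcsin_coef_ge0 k.
have k0 : 0 <= k%:R :> R by [].
have : (2 * k + 3)%:R * arcsin_coef k.+1 <= (2 * k + 3)%:R * 1.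
  rewrite h mulr1 !natr2D; nra.
by rewrite ler_pM2l// ltr0n addn3.
Qed.

(** With y = sin x, a partial sum of sqrt(1 - y^2) (arcsin y / sqrt(1 - y^2)),
    hence an approximation of x. *)
Definition arcsin_sum K (x : R) : R :=
  cos x * \sum_(0 <= k < K) arcsin_coef k * sin x ^+ (2 * k + 1).

(** The derivative of cos x sin^(2k+1) x is (2k+1) sin^(2k) x - (2k+2)
    sin^(2k+2) x, so by the recurrence for the coefficients consecutive terms
    cancel. *)
Lemma is_derive_arcsin_sum K (x : R) : is_derive x 1 (arcsin_sum K)
  (1 - (2 * K + 1)%:R * arcsin_coef K * sin x ^+ (2 * K)).
Proof.
have d k : is_derive x 1 (fun y : R => arcsin_coef k * sin y ^+ (2 * k + 1))
    (arcsin_coef k * ((2 * k + 1)%:R * sin x ^+ (2 * k + 1).-1 * cos x)).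
  by apply: is_derive_scale_fun; apply: is_deriveX_fun; exact: is_derive_sin.
apply: is_derive_eq (is_deriveM_fun _ _ _ _ _ (is_derive_cos x)
  (is_derive_sum_fun _ _ _ K d)) _.
rewrite big_distrr big_distrr/= -big_split/=.
rewrite (telescope_sumr_eq (fun k =>
   - ((2 * k + 1)%:R * arcsin_coef k * sin x ^+ (2 * k))))//.
  by rewrite muln0 expr0 {2}/arcsin_coef bin0 expr0 add0n !mulr1 divr1 mulr1 opprK addrC.
move=> k _; have := arcsin_coef_rec k.
rewrite (_ : (2 * k.+1 + 1 = 2 * k + 3)%N); last by lia.
rewrite (_ : (2 * k.+1 = (2 * k).+2)%N); last by lia.
rewrite addn1/= -[(2 * k).+1]addn1 => ->; rewrite !natr2D addn1 !exprS.
have := cos2Dsin2 x; move: (cos x) (sin x) => c s E.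
move: (s ^+ (2 * k)) => t.
have -> : c * (arcsin_coef k * ((2 * k%:R + 1) * t * c))
    = arcsin_coef k * (2 * k%:R + 1) * t * (1 - s ^+ 2).
  by rewrite -E; ring.
by ring.
Qed.

(** The coefficients are at most 1, so the derivative differs from 1 by a
    quantity that decays geometrically as long as sin x stays away from 1. *)
Lemma arcsin_sum_bound K (x : R) : 0 <= x <= pi / 2 ->
  `|arcsin_sum K x - x| <= (2 * K + 1)%:R * sin x ^+ (2 * K) * x.
Proof.
move=> /andP[x0 xpi].
have d (y : R) : is_derive y 1 (fun z : R => arcsin_sum K z - z)
    (1 - (2 * K + 1)%:R * arcsin_coef K * sin y ^+ (2 * K) - 1).
  by apply: is_deriveB_fun; exact: is_derive_arcsin_sum.
have := @mean_value_bound _ _ _ 0 x ((2 * K + 1)%:R * sin x ^+ (2 * K)) x0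
  (fun y _ => d y).
rewrite {2}/arcsin_sum !subr0 big1 ?mulr0 ?subr0; last first.
  by move=> k _; rewrite sin0 expr0n addn1/= mulr0.
apply=> y /andP[y0 yx].
have sy0 : 0 <= sin y by rewrite sin_ge0_pi// y0/=; have := pi_ge0 R; lra.
rewrite addrAC subrr sub0r normrN ger0_norm; last first.
  by rewrite !mulr_ge0 ?exprn_ge0 ?arcsin_coef_ge0.
rewrite -mulrA ler_wpM2l// -[leRHS]mul1r.
rewrite ler_pM ?arcsin_coef_ge0 ?arcsin_coef_le1 ?exprn_ge0//.
have sxy : sin y <= sin x.
  have ix : x \in `[(- (pi/2)), pi/2] by rewrite in_itv/= xpi andbT; lra.
  have iy : y \in `[(- (pi/2)), pi/2] by rewrite in_itv/=; apply/andP; lra.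
  have [->//|yx'] := eqVneq y x.
  by apply: ltW; rewrite ltr_sin// lt_neqAle yx'.
by rewrite lerXn2r ?nnegrE// (le_trans sy0).
Qed.
End Arcsin.

(** * The Fourier series of log tan(x/2) *)

Section LogTan.
Context {R : realType}.

(** Multiplying by 2 sin x turns each sine into a difference of cosines of
    consecutive even multiples of x. *)
Lemma sum_sin_odd K (x : R) :
  2 * sin x * \sum_(0 <= k < K) sin ((2 * k + 1)%:R * x)
  = 1 - cos ((2 * K)%:R * x).
Proof.
rewrite big_distrr/= (telescope_sumr_eq (fun k => - cos ((2 * k)%:R * x)))//.
  by rewrite muln0 mul0r cos0 opprK addrC.
move=> k _; rewrite natrD.
rewrite (_ : (2 * k.+1)%:R * x = (2 * k)%:R * x + x + x); last first.
  by rewrite (_ : (2 * k.+1 = 2 * k + 2)%N) ?natr2D ?natrM; [ring | lia].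
rewrite (_ : cos ((2 * k)%:R * x) = cos ((2 * k)%:R * x + x - x)); last first.
  by rewrite addrK.
have -> : ((2 * k)%:R + 1) * x = (2 * k)%:R * x + x by ring.
by rewrite (cosD (_ + x) x) (cosB (_ + x) x); ring.
Qed.

Lemma sin_natmulpi k : sin (k%:R * pi) = 0 :> R.
Proof.
elim: k => [|k IH]; first by rewrite mul0r sin0.
by rewrite -natr1 mulrDl mul1r sinDpi IH oppr0.
Qed.

Lemma sin_gt0_lepihalf (x : R) : 0 < x <= pi / 2 -> 0 < sin x.
Proof.
move=> /andP[x0 xpi]; apply: sin_gt0_pi.
by rewrite x0/=; have := pi_gt0 R; lra.
Qed.

Lemma sin_le_mono (x y : R) :
  - (pi / 2) <= x -> x <= y -> y <= pi / 2 -> sin x <= sin y.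
Proof.
move=> xpi xy ypi; have [->//|xy'] := eqVneq x y.
apply: ltW; rewrite ltr_sin ?lt_neqAle ?xy' ?in_itv//=; apply/andP; lra.
Qed.

Lemma tan_half_gt0 (x : R) : 0 < x <= pi / 2 -> 0 < tan (x / 2).
Proof.
move=> /andP[x0 xpi]; have p0 := pi_gt0 R; rewrite /tan divr_gt0//.
  by rewrite sin_gt0_lepihalf//; apply/andP; lra.
by rewrite cos_gt0_pihalf//; apply/andP; lra.
Qed.

Lemma is_derive_ln_tan_half (x : R) : 0 < x <= pi / 2 ->
  is_derive x 1 (fun y : R => ln (tan (y / 2))) (sin x)^-1.
Proof.
move=> xpi; have p0 := pi_gt0 R; have t0 := tan_half_gt0 _ xpi.
have s0 := sin_gt0_lepihalf _ xpi.
have c0 : 0 < cos (x / 2).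
  by move: xpi => /andP[x0 xpi]; rewrite cos_gt0_pihalf//; apply/andP; lra.
have dhalf : is_derive x 1 (fun y : R => y / 2) (2^-1).
  rewrite (_ : (fun _ => _) = (fun y : R => 2^-1 * y)).
    exact: is_derive_mulc.
  by apply/funext => y; rewrite mulrC.
have dtan : is_derive x 1 (fun y : R => tan (y / 2)) (cos (x / 2) ^- 2 * 2^-1).
  by apply: (is_derive_comp_fun (@tan R)) dhalf; apply: is_derive_tan; rewrite gt_eqF.
apply: is_derive_eq (is_derive_comp_fun (@ln R) (fun y : R => tan (y / 2)) _ _ _
  (is_derive1_ln t0) dtan) _.
have -> : sin x = 2 * sin (x / 2) * cos (x / 2).
  by rewrite {1}[x]splitr sinD; ring.
move: c0 t0; rewrite /tan; move: (cos _) (sin _) => c s c0.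
rewrite pmulr_lgt0 ?invr_gt0// => t0.
by field; rewrite !gt_eqF.
Qed.

Definition cos_sum K (x : R) : R :=
  \sum_(0 <= k < K) cos ((2 * k + 1)%:R * x) / (2 * k + 1)%:R.

Lemma is_derive_cos_sum K (x : R) :
  is_derive x 1 (cos_sum K) (- \sum_(0 <= k < K) sin ((2 * k + 1)%:R * x)).
Proof.
have d k : is_derive x 1 (fun y : R => cos ((2 * k + 1)%:R * y) / (2 * k + 1)%:R)
   (- sin ((2 * k + 1)%:R * x)).
  rewrite (_ : (fun _ => _) =
    (fun y : R => (2 * k + 1)%:R^-1 * cos ((2 * k + 1)%:R * y))); last first.
    by apply/funext => y; rewrite mulrC.
  apply: is_derive_eq (is_derive_scale_fun _ _ _ _ (is_derive_comp_fun (@cos R) _ _ _ _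
    (is_derive_cos _) (is_derive_mulc _ _))) _.
  by rewrite mulrC mulfK// pnatr_eq0 addn1.
rewrite -sumrN; exact: is_derive_sum_fun d.
Qed.

(** By sum_sin_odd the error of the partial Fourier sum has derivative
    cos(2Kx) / sin x.  Subtracting the oscillating term
    sin(2Kx) / (2K sin x), that is, integrating by parts once, leaves a function
    g that vanishes at pi/2 and whose derivative is O(1/K) away from 0. *)
Lemma ln_tan_cos_sum_bound K (a x : R) : (0 < K)%N -> 0 < a -> a <= x <= pi / 2 ->
  `|ln (tan (x / 2)) + 2 * cos_sum K x| <= 2 / sin a ^+ 2 / K%:R.
Proof.
move=> K0 a0 /andP[ax xpi].
have p0 := pi_gt0 R.
have Kp : 0 < K%:R :> R by rewrite ltr0n.
have sa0 : 0 < sin a by apply: sin_gt0_lepihalf; rewrite a0 (le_trans ax).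
have say y : a <= y <= pi / 2 -> sin a <= sin y.
  by move=> /andP[ay ypi]; apply: sin_le_mono => //; lra.
pose r (y : R) := sin ((2 * K)%:R * y) / ((2 * K)%:R * sin y).
pose g (y : R) := ln (tan (y / 2)) + 2 * cos_sum K y - r y.
pose dg (y : R) := sin ((2 * K)%:R * y) * cos y / ((2 * K)%:R * sin y ^+ 2).
have gd y : a <= y <= pi / 2 -> is_derive y 1 g (dg y).
  move=> yI; have sy0 : 0 < sin y by apply: lt_le_trans (say _ yI).
  have yI' : 0 < y <= pi / 2.
    by move: yI => /andP[ay ->]; rewrite (lt_le_trans a0).
  have d1 : is_derive y 1 (fun z : R => (2 * K)%:R * sin z) ((2 * K)%:R * cos y).
    by apply: is_derive_scale_fun; exact: is_derive_sin.
  have d2 : is_derive y 1 (fun z : R => sin ((2 * K)%:R * z))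
      (cos ((2 * K)%:R * y) * (2 * K)%:R).
    exact: is_derive_comp_fun (is_derive_sin _) (is_derive_mulc _ _).
  apply: is_derive_eq (is_deriveB_fun _ _ _ _ _
    (is_deriveD_fun _ _ _ _ _ (is_derive_ln_tan_half _ yI')
      (is_derive_scale_fun _ _ _ _ (is_derive_cos_sum K y)))
    (is_deriveM_fun _ _ _ _ _ d2 (is_deriveV_fun _ _ _ _ d1))) _.
    by rewrite mulf_neq0 ?gt_eqF// ltr0n muln_gt0.
  have /(canRL (mulKf _)) := sum_sin_odd K y.
  rewrite mulf_neq0 ?gt_eqF// => /(_ isT) ->.
  rewrite /dg natrM; move: (sin (_ * _)) (cos (_ * _)) => S C.
  by field; rewrite !gt_eqF.
have dgM y : a <= y <= pi / 2 -> `|dg y| <= (2 * K%:R * sin a ^+ 2)^-1.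
  move=> yI; have sy0 : 0 < sin y by apply: lt_le_trans (say _ yI).
  have D0 : 0 < 2 * K%:R * sin y ^+ 2 by rewrite !mulr_gt0 ?exprn_gt0.
  rewrite /dg natrM normrM normfV (gtr0_norm D0) -[leRHS]mul1r.
  rewrite ler_pM ?invr_ge0 ?(ltW D0)//.
    by rewrite normrM mulr_ile1 ?sin_max ?cos_max.
  rewrite lef_pV2 ?posrE ?mulr_gt0 ?exprn_gt0//.
  by rewrite ler_wpM2l ?mulr_ge0// lerXn2r ?nnegrE ?(ltW sy0) ?(ltW sa0) ?say.
have sin2K : sin ((2 * K)%:R * (pi / 2)) = 0 :> R.
  rewrite (_ : _ * _ = K%:R * pi); last by rewrite natrM; field.
  exact: sin_natmulpi.
have gpi : g (pi / 2) = 0.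
  rewrite /g /r sin2K mul0r subr0 (_ : pi / 2 / 2 = pi / 4); last by field.
  rewrite tan_piquarter ln1 add0r /cos_sum big1 ?mulr0// => k _.
  rewrite natr2D.
  have -> : (2 * k%:R + 1) * (pi / 2) = k%:R * pi + pi / 2 :> R by field.
  by rewrite cosDpihalf sin_natmulpi oppr0 mul0r.
have gx : `|g x| <= (2 * K%:R * sin a ^+ 2)^-1 * (pi / 2).
  rewrite -normrN -sub0r -gpi.
  apply: le_trans (_ : (2 * K%:R * sin a ^+ 2)^-1 * (pi / 2 - x) <= _).
    apply: (@mean_value_bound _ g dg) => // y /andP[xy ypi].
      by apply: gd; rewrite ypi (le_trans ax).
    by apply: dgM; rewrite ypi (le_trans ax).
  have ix : pi / 2 - x <= pi / 2 by lra.
  by apply: ler_wpM2l ix; rewrite invr_ge0 ?mulr_ge0 ?exprn_ge0 ?(ltW sa0).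
have rx : `|r x| <= (2 * K%:R * sin a ^+ 2)^-1.
  have sax := say x (introT andP (conj ax xpi)).
  have D0 : 0 < 2 * K%:R * sin x by rewrite !mulr_gt0// (lt_le_trans sa0).
  rewrite /r natrM normrM normfV (gtr0_norm D0) -[leRHS]mul1r.
  rewrite ler_pM ?invr_ge0 ?(ltW D0) ?sin_max//.
  rewrite lef_pV2 ?posrE ?D0 ?mulr_gt0 ?exprn_gt0// ler_wpM2l ?mulr_ge0//.
  by apply: le_trans sax; rewrite expr2 -[leRHS]mulr1 ler_wpM2l ?sin_le1 ?(ltW sa0).
rewrite (_ : _ + _ = g x + r x); last by rewrite /g subrK.
apply: le_trans (ler_normD _ _) _.
apply: le_trans (lerD gx rx) _.
have pi2 := pihalf_lt2 R.
have -> : 2 / sin a ^+ 2 / K%:R = 4 * (2 * K%:R * sin a ^+ 2)^-1.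
  by field; rewrite !gt_eqF.
have : 0 <= (2 * K%:R * sin a ^+ 2)^-1.
  by rewrite invr_ge0 ?mulr_ge0 ?exprn_ge0 ?(ltW sa0).
nra.
Qed.

End LogTan.

(** * The truncated difference of the two antiderivatives *)

Section Defect.
Context {R : realType}.

(** A partial sum of the antiderivative of 2 / sin x times the expansion of x
    given by arcsin_sum. *)
Definition arcsin_series K (x : R) : R :=
  \sum_(0 <= k < K)
    (2 * sin x) ^+ (2 * k + 1) / ((2 * k + 1)%:R ^+ 2 * 'C(2 * k, k)%:R).

Definition sin_sum K (x : R) : R :=
  \sum_(0 <= k < K) sin ((2 * k + 1)%:R * x) / (2 * k + 1)%:R ^+ 2.

Definition defect K (x : R) : R :=
  arcsin_series K x - 2 * x * ln (tan (x / 2)) - 4 * sin_sum K x.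

Lemma is_derive_arcsin_series K (x : R) : sin x != 0 ->
  is_derive x 1 (arcsin_series K) (2 / sin x * arcsin_sum K x).
Proof.
move=> sx0.
pose c k : R := 2 ^+ (2 * k + 1) / ((2 * k + 1)%:R ^+ 2 * 'C(2 * k, k)%:R).
have d k : is_derive x 1 (fun y : R =>
    (2 * sin y) ^+ (2 * k + 1) / ((2 * k + 1)%:R ^+ 2 * 'C(2 * k, k)%:R))
   (c k * ((2 * k + 1)%:R * sin x ^+ (2 * k + 1).-1 * cos x)).
  rewrite (_ : (fun _ => _) = (fun y : R => c k * sin y ^+ (2 * k + 1))).
    by apply: is_derive_scale_fun; apply: is_deriveX_fun; exact: is_derive_sin.
  by apply/funext => y; rewrite exprMn mulrAC.
apply: is_derive_eq (is_derive_sum_fun _ _ _ K d) _.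
rewrite /arcsin_sum mulrA big_distrr/=; apply: eq_bigr => k _.
rewrite /c /arcsin_coef addn1/= !exprS !exprM.
rewrite (_ : 2 ^+ 2 = 4 :> R); last by rewrite -natrX.
have := @central_bin_gt0 R k; move: 'C(_, _)%:R (4 ^+ k) ((_ ^+ 2) ^+ k) => C p q C0.
have h : (2 * k).+1%:R != 0 :> R by [].
move: h; move: (2 * k).+1%:R => m m0.
by field; rewrite (gt_eqF C0) m0 sx0.
Qed.

Lemma is_derive_sin_sum K (x : R) : is_derive x 1 (sin_sum K) (cos_sum K x).
Proof.
have d k : is_derive x 1 (fun y : R => sin ((2 * k + 1)%:R * y) / (2 * k + 1)%:R ^+ 2)
   (cos ((2 * k + 1)%:R * x) / (2 * k + 1)%:R).
  rewrite (_ : (fun _ => _) =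
    (fun y : R => ((2 * k + 1)%:R ^+ 2)^-1 * sin ((2 * k + 1)%:R * y))); last first.
    by apply/funext => y; rewrite mulrC.
  apply: is_derive_eq (is_derive_scale_fun _ _ _ _ (is_derive_comp_fun (@sin R) _ _ _ _
    (is_derive_sin _) (is_derive_mulc _ _))) _.
  have h : (2 * k + 1)%:R != 0 :> R by rewrite addn1.
  move: h; move: (2 * k + 1)%:R => m m0.
  by field.
exact: is_derive_sum_fun d.
Qed.

Lemma is_derive_defect K (x : R) : 0 < x <= pi / 2 ->
  is_derive x 1 (defect K) (2 / sin x * (arcsin_sum K x - x)
    - 2 * (ln (tan (x / 2)) + 2 * cos_sum K x)).
Proof.
move=> xI; have sx0 := sin_gt0_lepihalf _ xI.
apply: is_derive_eq (is_deriveB_fun _ _ _ _ _ (is_deriveB_fun _ _ _ _ _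
  (is_derive_arcsin_series K x _)
  (is_deriveM_fun _ _ _ _ _ (is_derive_mulc 2 x) (is_derive_ln_tan_half _ xI)))
  (is_derive_scale_fun _ _ _ _ (is_derive_sin_sum K x))) _; rewrite ?gt_eqF//.
by field; rewrite gt_eqF.
Qed.

Definition defect_modulus (a b : R) K : R :=
  2 / sin a * ((2 * K + 1)%:R * sin b ^+ (2 * K) * (pi / 2))
  + 2 * (2 / sin a ^+ 2 / K%:R).

(** In the derivative of the defect the term x / sin x cancels; what remains are
    the two truncation errors, bounded by arcsin_sum_bound and
    ln_tan_cos_sum_bound. *)
Lemma defect_bound (a b x : R) K : (0 < K)%N -> 0 < a -> b < pi / 2 ->
  a <= x <= b -> `|defect K x - defect K a| <= defect_modulus a b K * (pi / 2).
Proof.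
move=> K0 a0 bpi /andP[ax xb].
have sa0 : 0 < sin a by apply: sin_gt0_lepihalf; rewrite a0/=; lra.
apply: le_trans (_ : _ <= defect_modulus a b K * (x - a)) _; last first.
  rewrite ler_wpM2l//; last by lra.
  rewrite /defect_modulus addr_ge0// ?mulr_ge0 ?invr_ge0 ?exprn_ge0
    ?(ltW sa0) ?(ltW (@pi_gt0 R))//.
  by rewrite ltW// sin_gt0_lepihalf//; apply/andP; lra.
apply: mean_value_bound => // y /andP[ay yx].
  by apply: is_derive_defect; apply/andP; lra.
have say : sin a <= sin y by apply: sin_le_mono => //; lra.
have syb : sin y <= sin b by apply: sin_le_mono => //; lra.
have sy0 : 0 < sin y by apply: lt_le_trans say.
apply: le_trans (ler_normB _ _) _; apply: lerD.
  rewrite normrM ger0_norm; last by rewrite divr_ge0 ?(ltW sy0).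
  apply: ler_pM => //; first by rewrite divr_ge0 ?(ltW sy0).
    by rewrite ler_pM2l// lef_pV2.
  have yI : 0 <= y <= pi / 2 by apply/andP; lra.
  apply: le_trans (arcsin_sum_bound K _ yI) _.
  have ypi : y <= pi / 2 by lra.
  rewrite ler_pM ?mulr_ge0 ?exprn_ge0 ?(ltW sy0)//; first by lra.
  by rewrite ler_wpM2l// lerXn2r ?nnegrE ?(ltW sy0)// (le_trans (ltW sy0)).
rewrite normrM ger0_norm// ler_pM2l//.
by apply: ln_tan_cos_sum_bound => //; apply/andP; lra.
Qed.

Lemma linear_geometric_cvg0 (q : R) : 0 <= q < 1 ->
  (fun K => (2 * K + 1)%:R * q ^+ (2 * K)) @ \oo --> (0 : R).
Proof.
move=> /andP[q0 q1].
(* Bernoulli's inequality for 1 / q, weakened by 1 - q <= 1 / q - 1 and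
   multiplied by q ^+ K, which covers q = 0. *)
have bernoulli K : q ^+ K * (1 + K%:R * (1 - q)) <= 1.
  elim: K => [|K IH]; first by rewrite mul0r addr0 mulr1.
  apply: le_trans IH; rewrite exprSr -mulrA ler_wpM2l ?exprn_ge0//.
  have K0 : 0 <= K%:R :> R by [].
  have : 0 <= (1 - q) ^+ 2 * (K%:R + 1) by rewrite mulr_ge0 ?sqr_ge0 ?addr_ge0.
  by rewrite -natr1; lra.
have q1' : 0 < 1 - q by lra.
apply: (@squeeze_cvgr _ _ _ _ (fun=> 0) (geometric (2 / (1 - q) + 1) q)); last 2 first.
- exact: cvg_cst.
- by apply: cvg_geometric; rewrite ger0_norm.
apply: nearW => K /=; rewrite mulr_ge0 ?exprn_ge0//=.
rewrite mulnC exprM expr2 mulrA ler_wpM2r ?exprn_ge0//.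
have qK1 : q ^+ K <= 1 by rewrite exprn_ile1 // ltW.
have : q ^+ K * K%:R <= (1 - q)^-1.
  rewrite -[leRHS]mul1r ler_pdivlMr// -mulrA; apply: le_trans (bernoulli K).
  by rewrite ler_wpM2l ?exprn_ge0// lerDr.
rewrite natrD natrM; lra.
Qed.

Lemma sum_signs_even n : ~~ odd n -> \sum_(0 <= i < n) (-1) ^+ i = 0 :> R.
Proof.
move=> en; rewrite -(odd_double_half n) (negbTE en) add0n.
elim: n./2 => [|m IH]; first by rewrite big_nil.
by rewrite doubleS !big_nat_recr//= IH exprS; ring.
Qed.

Lemma cvg_scale (c : R) (v : nat -> R) (l : R) :
  v @ \oo --> l -> (fun K => c * v K) @ \oo --> c * l.
Proof. by move=> vl; apply: cvgM => //; exact: cvg_cst. Qed.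

Lemma defect_modulus_cvg0 (a b : R) : 0 < b < pi / 2 ->
  defect_modulus a b @ \oo --> (0 : R).
Proof.
move=> /andP[b0 bpi]; have pi0 := @pi_gt0 R.
have sb : 0 <= sin b < 1.
  rewrite (ltW (sin_gt0_lepihalf _ _)) ?b0 ?ltW//= -[ltRHS]sin_pihalf ltr_sin//.
  - by rewrite in_itv/=; apply/andP; lra.
  - by rewrite in_itv/=; apply/andP; lra.
have h1 : (fun K : nat => K%:R^-1) @ \oo --> (0 : R).
  by rewrite -cvg_shiftS; exact: cvg_harmonic.
have := cvgD (cvg_scale (2 / sin a * (pi / 2)) _ _ (linear_geometric_cvg0 _ sb))
  (cvg_scale (4 / sin a ^+ 2) _ _ h1).
rewrite !mulr0 addr0 => lim0.
rewrite (_ : defect_modulus a b = fun K : nat =>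
  2 / sin a * (pi / 2) * ((2 * K + 1)%:R * sin b ^+ (2 * K))
  + 4 / sin a ^+ 2 * K%:R^-1); first exact: lim0.
by apply/funext => K; rewrite /defect_modulus; ring.
Qed.

(** As the signs add up to 0, the value at the left end point may be subtracted
    from each defect; only the variation of the defect matters. *)
Lemma alternating_defect_cvg0 (n : nat) (x : nat -> R) (a b : R) : ~~ odd n ->
  0 < a -> b < pi / 2 -> a <= b -> (forall i, (i < n)%N -> a <= x i <= b) ->
  (fun K => \sum_(0 <= i < n) (-1) ^+ i * defect K (x i)) @ \oo --> (0 : R).
Proof.
move=> en a0 bpi ab xI.
have e K : \sum_(0 <= i < n) (-1) ^+ i * defect K (x i)
    = \sum_(0 <= i < n) (-1) ^+ i * (defect K (x i) - defect K a).
  under [in RHS]eq_bigr do rewrite mulrBr.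
  by rewrite sumrB -big_distrl/= sum_signs_even// mul0r subr0.
have bound K : (0 < K)%N -> `|\sum_(0 <= i < n) (-1) ^+ i * defect K (x i)| <=
   n%:R * (defect_modulus a b K * (pi / 2)).
  move=> K0; rewrite e; apply: le_trans (ler_norm_sum _ _ _) _.
  rewrite mulr_natl -[n in leRHS]subn0 -sumr_const_nat !big_nat.
  apply: ler_sum => i /andP[_ iN].
  rewrite normrM normrX normrN1 expr1n mul1r; exact: defect_bound (xI _ iN).
have b0 : 0 < b by apply: lt_le_trans ab.
have b0pi : 0 < b < pi / 2 by rewrite b0.
have := cvg_scale (n%:R * (pi / 2)) _ _ (defect_modulus_cvg0 a b b0pi).
rewrite mulr0 => modulus0.
apply/norm_cvg0P; apply: (squeeze_cvgr _ _ modulus0); last exact: cvg_cst.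
near=> K; rewrite normr_ge0/= -mulrA [pi / 2 * _]mulrC; apply: bound.
by near: K; exists 1%N.
Unshelve. all: by end_near.
Qed.
End Defect.

(** * Sine sums at the nodes *)

Section Catalan.
Context {R : realType}.

Definition catalan_sum K : R :=
  \sum_(0 <= k < K) (-1) ^+ k / (2 * k + 1)%:R ^+ 2.

Lemma catalan_sum_cvg : catalan_sum @ \oo --> catalan_constant R.
Proof.
have sE : series (fun k : nat => (-1) ^+ k / (2 * k + 1)%:R ^+ 2 : R) = catalan_sum.
  by [].
suff : cvgn (series (fun k : nat => (-1) ^+ k / (2 * k + 1)%:R ^+ 2 : R)).
  by rewrite /catalan_constant sE.
apply: normed_cvg; rewrite /normed_series_of/=.
(* The majorant is 2 / ((k+1)(k+2)), which telescopes. *)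
pose v : nat -> R := fun k => - (2 * harmonic k).
apply: (@series_le_cvg _ _ (telescope v)) => [k|k|k|] //=.
- have k0 : 0 <= k%:R :> R by [].
  have k1 : 0 < k.+1%:R :> R by [].
  have k2 : 0 < k.+2%:R :> R by [].
  rewrite /telescope /v /= opprK addrC subr_ge0 ler_pM2l// lef_pV2 ?posrE//.
  by rewrite ler_nat.
- rewrite /telescope /v /= normrM normfV !normrX normrN1 expr1n normr_nat mul1r.
  have k0 : 0 <= k%:R :> R by [].
  have -> : - (2 / k.+2%:R) - - (2 / k.+1%:R)
      = (((k%:R + 1) * (k%:R + 2)) / 2)^-1 :> R.
    by rewrite -(natr1 k.+1) -(natr1 k); field; rewrite !gt_eqF//; lra.
  rewrite lef_pV2 ?posrE; last 2 first.
  + by rewrite exprn_gt0// ltr0n addn1.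
  + by rewrite divr_gt0// mulr_gt0//; lra.
  by rewrite natr2D; nra.
- rewrite telescopeK; apply: is_cvgB; last exact: is_cvg_cst.
  apply: is_cvgN; apply: cvgP (cvg_scale 2 _ _ cvg_harmonic).
Qed.

Lemma sin_natmulpiD k (y : R) : sin (k%:R * pi + y) = (-1) ^+ k * sin y.
Proof.
elim: k => [|k IH]; first by rewrite mul0r add0r mul1r.
by rewrite -natr1 mulrDl mul1r addrAC sinDpi IH exprS mulN1r mulNr.
Qed.

(** The product 2 cos phi sin((2i+1) phi) is a sum of sines of consecutive even
    multiples of phi, which the alternating signs make telescope. *)
Lemma telescoping_sin_sum n (phi : R) :
  2 * cos phi * \sum_(0 <= i < n) (-1) ^+ i * sin ((2 * i + 1)%:R * phi)
  = - ((-1) ^+ n * sin ((2 * n)%:R * phi)).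
Proof.
rewrite big_distrr/= (telescope_sumr_eq
  (fun i => - ((-1) ^+ i * sin ((2 * i)%:R * phi))))//.
  by rewrite muln0 mul0r sin0 mulr0 oppr0 subr0.
move=> i _.
have -> : (2 * i.+1)%:R * phi = (2 * i + 1)%:R * phi + phi :> R.
  by rewrite natr2D natrM -(natr1 i); ring.
have -> : (2 * i)%:R * phi = (2 * i + 1)%:R * phi - phi :> R.
  by rewrite natr2D natrM; ring.
by rewrite sinD sinB exprS; ring.
Qed.

Definition node n i : R := (2 * i + 1)%:R * (pi / (2 * (2 * n + 1)%:R)).

Definition node_sin_sum n k : R :=
  \sum_(0 <= i < n) (-1) ^+ i * sin ((2 * k + 1)%:R * node n i).

Lemma cos_node_neq0 n k : (k < 2 * n + 1)%N -> k != n -> cos (node n k) != 0.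
Proof.
move=> kN kn; have pi0 := @pi_gt0 R.
have N0 : 0 < (2 * n + 1)%:R :> R by rewrite ltr0n addn1.
have e : node n k = pi / 2 + (k%:R - n%:R) * (pi / (2 * n + 1)%:R).
  move: N0; rewrite /node !natr2D => N0; field; exact: lt0r_neq0.
have h0 : 0 < pi / (2 * n + 1)%:R :> R by rewrite divr_gt0.
have h1 : (2 * n%:R + 1) * (pi / (2 * n + 1)%:R) = pi :> R.
  by rewrite -[1]/(1%:R) -natr2D mulrC divfK// gt_eqF.
have n0 : 0 <= n%:R :> R by [].
move: kn; rewrite neq_ltn => /orP[kn|kn].
  rewrite gt_eqF// cos_gt0_pihalf// e.
  have : k.+1%:R <= n%:R :> R by rewrite ler_nat.
  have : 0 <= k%:R :> R by [].
  rewrite -natr1; move: h0 h1; move: (pi / (_)%:R) k%:R n%:R n0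
  => h x y y0 h0 h1 x0 xy.
  have : 0 < (y - x) * h by rewrite mulr_gt0//; lra.
  have : 0 < (x + y + 1) * h by rewrite mulr_gt0//; lra.
  by move=> *; apply/andP; split; lra.
rewrite e addrC cosDpihalf oppr_eq0 gt_eqF// sin_gt0_pi//.
have : n.+1%:R <= k%:R :> R by rewrite ler_nat.
have : k%:R <= 2 * n%:R :> R by rewrite -natrM ler_nat; lia.
rewrite -(natr1 n); move: h0 h1; move: (pi / (_)%:R) k%:R n%:R n0
  => h x y y0 h0 h1 x0 xy.
have : 0 < (x - y) * h by rewrite mulr_gt0//; lra.
have : 0 < (3 * y + 1 - x) * h by rewrite mulr_gt0//; lra.
by move=> *; apply/andP; split; lra.
Qed.

(** At k = n the angle node n k is pi/2, the telescoping identity degenerates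
    to 0 = 0, and every term of the sum equals 1; otherwise the cosine can be
    cancelled. *)
Lemma node_sin_sumE n k : ~~ odd n -> (k < 2 * n + 1)%N ->
  node_sin_sum n k = (-1) ^+ k * (if k == n then n%:R else - (1 / 2)).
Proof.
move=> en kN.
have N0 : 0 < (2 * n + 1)%:R :> R by rewrite ltr0n addn1.
have -> : node_sin_sum n k = \sum_(0 <= i < n) (-1) ^+ i * sin ((2 * i + 1)%:R * node n k).
  by apply: eq_bigr => i _; rewrite /node mulrCA.
have sgn : (-1) ^+ n = 1 :> R by rewrite -signr_odd (negbTE en).
have [->|kn] := eqVneq k n.
  rewrite sgn mul1r.
  have -> : node n n = pi / 2 by rewrite /node; field; rewrite gt_eqF.
  rewrite -[n in RHS]subn0 -sumr_const_nat; apply: eq_bigr => i _.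
  have -> : (2 * i + 1)%:R * (pi / 2) = i%:R * pi + pi / 2 :> R.
    by rewrite natr2D; field.
  by rewrite sin_natmulpiD sin_pihalf mulr1 -exprMn mulrNN mulr1 expr1n.
have c0 := cos_node_neq0 _ _ kN kn.
have c2 : 2 * cos (node n k) != 0 by rewrite mulf_neq0.
apply: (mulfI c2); rewrite telescoping_sin_sum sgn mul1r.
have -> : (2 * n)%:R * node n k = k%:R * pi + (pi / 2 - node n k).
  move: N0; rewrite /node !natr2D natrM => N0; field; exact: lt0r_neq0.
by rewrite sin_natmulpiD sinB sin_pihalf cos_pihalf; field.
Qed.

(** Raising k by a multiple l of 2n+1 adds l pi times an odd number to each
    angle. *)
Lemma node_sin_sum_period n l m : ~~ odd n ->
  node_sin_sum n ((2 * n + 1) * l + m) = (-1) ^+ l * node_sin_sum n m.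
Proof.
move=> en; rewrite /node_sin_sum big_distrr/=; apply: eq_bigr => i _.
have N0 : 0 < (2 * n + 1)%:R :> R by rewrite ltr0n addn1.
have -> : (2 * ((2 * n + 1) * l + m) + 1)%:R * node n i
   = ((2 * i + 1) * l)%:R * pi + (2 * m + 1)%:R * node n i.
  rewrite /node natr2D natrD !natrM; move: N0; rewrite !natr2D => N0.
  by field; exact: lt0r_neq0.
rewrite sin_natmulpiD mulrCA; congr (_ * _).
by rewrite -signr_odd oddM oddD mul2n odd_double/= signr_odd.
Qed.

(** The exceptional indices are k = (2n+1) l + n, where 2k+1 = (2n+1)(2l+1) and
    (-1)^k = (-1)^l because n is even; they contribute a scaled copy of the
    Catalan series with l as its index.  A multiple of 2n+1 as the upper limit
    makes both truncations exact. *)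
Lemma sum_node_sin_sum n L : ~~ odd n ->
  \sum_(0 <= k < (2 * n + 1) * L) node_sin_sum n k / (2 * k + 1)%:R ^+ 2
  = - (1 / 2) * catalan_sum ((2 * n + 1) * L)
    + (1 / (2 * (2 * n + 1)%:R)) * catalan_sum L.
Proof.
move=> en; have N0 : 0 < (2 * n + 1)%:R :> R by rewrite ltr0n addn1.
elim: L => [|L IH].
  by rewrite muln0 /catalan_sum !big_nil !mulr0 addr0.
have sgn : (-1) ^+ ((2 * n + 1) * L) = (-1) ^+ L :> R.
  by rewrite -signr_odd oddM oddD mul2n odd_double/= signr_odd.
have split_block (f : nat -> R) : \sum_(0 <= k < (2 * n + 1) * L.+1) f k
   = \sum_(0 <= k < (2 * n + 1) * L) f k
     + \sum_(0 <= m < 2 * n + 1) f ((2 * n + 1) * L + m)%N.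
  rewrite (@big_cat_nat _ _ _ ((2 * n + 1) * L)) //=; last by rewrite leq_mul2l leqnSn orbT.
  congr (_ + _); rewrite -[X in \sum_(X <= _ < _) _]add0n big_addn mulnS addnK.
  by apply: eq_bigr => m _; rewrite addnC.
rewrite /catalan_sum !split_block -/(catalan_sum _) IH.
rewrite [X in _ = _ + _ * X]big_nat_recr//= -/(catalan_sum _).
pose P m : R := (-1) ^+ ((2 * n + 1) * L + m) / (2 * ((2 * n + 1) * L + m) + 1)%:R ^+ 2.
have -> : \sum_(0 <= m < 2 * n + 1) node_sin_sum n ((2 * n + 1) * L + m)
     / (2 * ((2 * n + 1) * L + m) + 1)%:R ^+ 2
   = \sum_(0 <= m < 2 * n + 1) (- (1 / 2) * P m + (m == n)%:R * ((n%:R + 1 / 2) * P m)).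
  rewrite !big_nat; apply: eq_bigr => m /andP[_ mN].
  rewrite node_sin_sum_period// node_sin_sumE// /P exprD.
  by rewrite sgn; case: eqP => _; [rewrite mulr1n|rewrite mulr0n]; ring.
rewrite big_split/= -big_distrr/=.
have -> : \sum_(0 <= m < 2 * n + 1) (m == n)%:R * ((n%:R + 1 / 2) * P m)
    = (n%:R + 1 / 2) * P n.
  rewrite (bigD1_seq n) ?iota_uniq ?mem_index_iota//=; last by lia.
  by rewrite eqxx mulr1n mul1r big1 ?addr0// => m /negbTE ->; rewrite mulr0n mul0r.
have -> : P n = (-1) ^+ L / ((2 * n + 1)%:R ^+ 2 * (2 * L + 1)%:R ^+ 2).
  have sgn_n : (-1) ^+ n = 1 :> R by rewrite -signr_odd (negbTE en).
  rewrite /P exprD sgn sgn_n mulr1 -exprMn -natrM; congr (_ / _%:R ^+ 2); lia.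
have L0 : 0 < (2 * L + 1)%:R :> R by rewrite ltr0n addn1.
move: N0 L0; rewrite !natr2D => N0 L0.
rewrite -/(catalan_sum L) (_ : \sum_(0 <= m < 2 * n + 1)
  (-1) ^+ ((2 * n + 1) * L + m) / _ = \sum_(0 <= m < 2 * n + 1) P m)//.
move: (\sum_(0 <= m < 2 * n + 1) P m) => S.
by field; rewrite !gt_eqF.
Qed.

Lemma mul_cvg_oo N : (0 < N)%N -> (fun L => (N * L)%N) @ \oo --> \oo.
Proof.
move=> N0 A [M _ MA]; exists M => // L /= ML; apply: MA => /=.
by rewrite (leq_trans ML)// leq_pmull.
Qed.

Lemma alternating_sin_sum_cvg n : ~~ odd n ->
  (fun L => \sum_(0 <= i < n) (-1) ^+ i * sin_sum ((2 * n + 1) * L) (node n i))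
    @ \oo --> - (n%:R / (2 * n + 1)%:R) * catalan_constant R.
Proof.
move=> en; have N0 : 0 < (2 * n + 1)%:R :> R by rewrite ltr0n addn1.
have -> : (fun L => \sum_(0 <= i < n) (-1) ^+ i * sin_sum ((2 * n + 1) * L) (node n i))
  = (fun L => - (1 / 2) * catalan_sum ((2 * n + 1) * L)
    + (1 / (2 * (2 * n + 1)%:R)) * catalan_sum L).
  apply/funext => L; rewrite -sum_node_sin_sum//.
  under eq_bigr do rewrite /sin_sum big_distrr/=.
  rewrite exchange_big/=; apply: eq_bigr => k _.
  by rewrite /node_sin_sum big_distrl/=; apply: eq_bigr => i _; rewrite mulrA.
have -> : - (n%:R / (2 * n + 1)%:R) * catalan_constant R =
   - (1 / 2) * catalan_constant R + (1 / (2 * (2 * n + 1)%:R)) * catalan_constant R.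
  by move: N0; rewrite natr2D => N0; field; rewrite gt_eqF.
apply: cvgD; apply: cvg_scale; last exact: catalan_sum_cvg.
have sub : (fun L => ((2 * n + 1) * L)%N) @ \oo --> \oo.
  by apply: mul_cvg_oo; rewrite addn1.
exact: cvg_comp sub catalan_sum_cvg.
Qed.
End Catalan.

(** * Algebraic units *)

Section Unit.
Context {R : realType}.

(** The expansions of cos(m t) / sin(t)^m and sin(m t) / sin(t)^m in terms of
    cot t, that is, the real and imaginary parts of (X + i)^m. *)
Fixpoint cot_polys (m : nat) : {poly int} * {poly int} :=
  if m is m'.+1 then
    let: (A, B) := cot_polys m' in ('X * A - B, 'X * B + A)
  else (1, 0).

Lemma cot_polys_size m :
  [/\ (cot_polys m).1 \is monic, size (cot_polys m).1 = m.+1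
    & (size (cot_polys m).2 <= m)%N].
Proof.
elim: m => [|m]; first by rewrite /= monic1 size_poly1 size_poly0.
rewrite /=; case: (cot_polys m) => A B /= [Am sA sB].
have A0 : A != 0 by rewrite -size_poly_gt0 sA.
have sXA : size ('X * A) = m.+2 by rewrite mulrC size_mulX// sA.
have BXA : (size (- B)%R < size ('X * A)%R)%N by rewrite size_polyN sXA ltnS (leq_trans sB).
split.
- by rewrite monicE lead_coefDl// mulrC lead_coefMX -monicE.
- by rewrite size_polyDl.
- rewrite (leq_trans (size_polyD _ _))// geq_max sA leqnn andbT.
  by rewrite mulrC; have [->|B0] := eqVneq B 0; rewrite ?mul0r ?size_poly0// size_mulX.
Qed.

Lemma cot_polysE m (t : R) : sin t != 0 ->
  (map_poly intr (cot_polys m).1).[cos t / sin t] * sin t ^+ m = cos (m%:R * t) /\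
  (map_poly intr (cot_polys m).2).[cos t / sin t] * sin t ^+ m = sin (m%:R * t).
Proof.
move=> s0; elim: m => [|m] /=.
  by rewrite rmorph1 !rmorph0 !hornerE cos0 sin0.
case: (cot_polys m) => A B /= [EA EB].
rewrite !rmorphB !rmorphD !rmorphM /= map_polyX.
have -> : m.+1%:R * t = m%:R * t + t by rewrite -(natr1 m); ring.
rewrite !hornerE cosD sinD -EA -EB !exprS.
by split; field.
Qed.

Lemma algebraic_integer_cot m (t : R) : sin t != 0 -> cos (m%:R * t) = 0 ->
  algebraic_integer (cos t / sin t).
Proof.
move=> s0 c0; have [Am _ _] := cot_polys_size m.
exists (cot_polys m).1 => //; apply/eqP.
have [] := cot_polysE m _ s0; rewrite c0 => /eqP.
by rewrite mulf_eq0 expf_eq0 (negbTE s0) andbF orbF => /eqP.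
Qed.

(** The tangent of t is the cotangent of pi/2 - t, and its inverse is the
    cotangent of t; algebraic_integer_cot applies to both angles. *)
Lemma algebraic_unit_tan m (t : R) : sin t != 0 -> cos t != 0 ->
  cos (m%:R * t) = 0 -> cos (m%:R * (pi / 2 - t)) = 0 ->
  algebraic_unit (tan t).
Proof.
move=> s0 c0 ct ct'; split.
- by rewrite mulf_neq0 ?invr_eq0.
- have := algebraic_integer_cot m (pi / 2 - t).
  rewrite cosB sinB sin_pihalf cos_pihalf !mul0r !mul1r add0r subr0 => h.
  exact: h c0 ct'.
- by rewrite invf_div; exact: algebraic_integer_cot s0 ct.
Qed.

Lemma algebraic_unit1 : algebraic_unit (1 : R).
Proof. by split; rewrite ?oner_eq0 ?invr1//; exact: integral1. Qed.

Lemma algebraic_unitM (x y : R) :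
  algebraic_unit x -> algebraic_unit y -> algebraic_unit (x * y).
Proof.
move=> [x0 xi xvi] [y0 yi yvi]; split; first by rewrite mulf_neq0.
  exact: integral_mul.
by rewrite invfM; exact: integral_mul.
Qed.

Lemma algebraic_unitV (x : R) : algebraic_unit x -> algebraic_unit x^-1.
Proof. by case=> *; split; rewrite ?invr_eq0 ?invrK. Qed.

Lemma algebraic_unitXz (x : R) (z : int) : algebraic_unit x -> algebraic_unit (x ^ z).
Proof.
move=> xu; have xnu m : algebraic_unit (x ^+ m).
  elim: m => [|m IH]; first exact: algebraic_unit1.
  by rewrite exprS; exact: algebraic_unitM.
by case: z => m; [exact: xnu | apply/algebraic_unitV/xnu].
Qed.

Lemma half_nodeE n i :
  node n i / 2 = (2 * i + 1)%:R * (pi / (4 * (2 * n + 1)%:R)) :> R.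
Proof.
rewrite /node; have : (2 * n + 1)%:R != 0 :> R by rewrite addn1.
by move: (2 * n + 1)%:R => N N0; field.
Qed.

Lemma half_node_bounds n i : (i < n)%N -> 0 < @node R n i / 2 < pi / 4.
Proof.
move=> iN; have pi0 := @pi_gt0 R.
have N0 : 0 < (2 * n + 1)%:R :> R by rewrite ltr0n addn1.
rewrite half_nodeE; apply/andP; split.
  by rewrite !mulr_gt0 ?invr_gt0 ?mulr_gt0// ltr0n addn1.
have -> : pi / 4 = (2 * n + 1)%:R * (pi / (4 * (2 * n + 1)%:R)) :> R.
  by move: N0; move: (2 * n + 1)%:R => N N0; field; rewrite gt_eqF.
by rewrite ltr_pM2r ?ltr_nat ?divr_gt0 ?mulr_gt0//; lia.
Qed.

Lemma tan_half_node_unit n i : (i < n)%N -> algebraic_unit (tan (@node R n i / 2)).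
Proof.
move=> iN; have pi0 := @pi_gt0 R; have /andP[h0 h1] := half_node_bounds _ _ iN.
have N0 : 0 < (2 * n + 1)%:R :> R by rewrite ltr0n addn1.
have cN k : cos (k%:R * pi + pi / 2) = 0 :> R by rewrite cosDpihalf sin_natmulpi oppr0.
apply: (algebraic_unit_tan (2 * (2 * n + 1))).
- by rewrite gt_eqF// sin_gt0_lepihalf// h0/=; lra.
- by rewrite gt_eqF// cos_gt0_pihalf//; apply/andP; lra.
- rewrite half_nodeE -[RHS](cN i); congr cos.
  by rewrite natrM (natr2D i); field; rewrite gt_eqF.
- rewrite half_nodeE -[RHS](cN (2 * n - i)%N); congr cos.
  rewrite natrB; last by lia.
  move: N0; rewrite !natrM !natr2D => N0.
  by field; rewrite gt_eqF.
Qed.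
End Unit.

(** * The acceleration formula *)

Section Assembly.
Context {R : realType}.

Lemma uE n : u R n =
  \prod_(0 <= i < n) tan (@node R n i / 2) ^ ((2 * i + 1)%:Z * (-1) ^+ i).
Proof.
rewrite /u big_add1 /=; apply: eq_bigr => i _.
have -> : (2 * i.+1 - 1 = 2 * i + 1)%N by lia.
congr (tan _ ^ _); last by rewrite !exprS !mulN1r opprK.
rewrite half_nodeE (_ : (8 * n + 4 = 4 * (2 * n + 1))%N); last by lia.
by rewrite (natrM R 4) mulrA.
Qed.

Lemma u_unit n : algebraic_unit (u R n).
Proof.
rewrite uE big_nat; apply: big_ind => [||i /andP[_ iN]].
- exact: algebraic_unit1.
- exact: algebraic_unitM.
- exact/algebraic_unitXz/tan_half_node_unit.
Qed.

Lemma ln_exprz (x : R) (z : int) : 0 < x -> ln (x ^ z) = z%:~R * ln x.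
Proof.
move=> x0; case: z => m; first by rewrite lnXn// mulr_natl.
rewrite NegzE -exprnN lnV ?posrE ?exprn_gt0// lnXn//.
by rewrite mulrNz mulNr mulr_natl.
Qed.

Lemma node_bounds n i : (i < n)%N -> 0 < @node R n i < pi / 2.
Proof. by move=> /(@half_node_bounds R) /andP[h0 h1]; apply/andP; lra. Qed.

Lemma ln_u n : ln (u R n) =
  \sum_(0 <= i < n) (-1) ^+ i * ((2 * i + 1)%:R * ln (tan (@node R n i / 2))).
Proof.
rewrite uE.
suff : forall m, (m <= n)%N ->
  0 < \prod_(0 <= i < m) tan (@node R n i / 2) ^ ((2 * i + 1)%:Z * (-1) ^+ i) /\
  ln (\prod_(0 <= i < m) tan (@node R n i / 2) ^ ((2 * i + 1)%:Z * (-1) ^+ i)) =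
  \sum_(0 <= i < m) (-1) ^+ i * ((2 * i + 1)%:R * ln (tan (@node R n i / 2))).
  by move=> /(_ n (leqnn n)) [].
elim=> [|m IH] mn; first by rewrite !big_nil ln1.
have [p0 plog] := IH (ltnW mn).
have t0 : 0 < tan (@node R n m / 2).
  by apply: tan_half_gt0; have /andP[-> /ltW] := node_bounds _ _ mn.
rewrite !big_nat_recr//=; split; first by rewrite mulr_gt0// exprz_gt0.
rewrite lnM ?posrE ?exprz_gt0// plog ln_exprz//; congr (_ + _).
rewrite intrM rmorphXn/= rmorphN1; ring.
Qed.

(** The index j corresponds to the node i = n - j, for which
    j pi / (2n+1) = pi/2 - node n i; as n is even, j and i have the same parity,
    and the exponent 2k+1 is odd. *)
Lemma FE n k : ~~ odd n -> F R n (2 * k + 1) =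
  \sum_(0 <= i < n) (-1) ^+ i * (2 * sin (@node R n i)) ^+ (2 * k + 1).
Proof.
move=> en; rewrite /F big_add1/= big_nat_rev/= !big_nat.
apply: eq_bigr => i /andP[_ iN].
have -> : (0 + n - i.+1).+1 = (n - i)%N by lia.
have sgn : (-1) ^+ (n - i) = (-1) ^+ i :> R.
  by rewrite -signr_odd oddB ?(ltnW iN)// (negbTE en)/= signr_odd.
have -> : (n - i)%:R * pi / (2 * n + 1)%:R = pi / 2 - @node R n i.
  have N0 : 0 < (2 * n + 1)%:R :> R by rewrite ltr0n addn1.
  move: N0; rewrite natrB ?(ltnW iN)// /node !natr2D => N0.
  by field; rewrite gt_eqF.
rewrite cosB cos_pihalf sin_pihalf mul0r add0r mul1r sgn -mulrA exprMn.
by congr (_ * _);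
  rewrite -exprM mulnDr muln1 exprD mulnCA exprM sqrrN !expr1n mul1r.
Qed.

Lemma series_accelerationE n K : ~~ odd n ->
  series (acceleration_term R n) K =
  \sum_(0 <= i < n) (-1) ^+ i * arcsin_series K (@node R n i).
Proof.
move=> en; rewrite /series/=.
under [in RHS]eq_bigr do rewrite /arcsin_series big_distrr/=.
rewrite exchange_big/=; apply: eq_bigr => k _.
rewrite /acceleration_term FE// big_distrl/=.
by apply: eq_bigr => i _; rewrite mulrA.
Qed.

(** The coefficients arcsin_coef are at most 1, so the terms are dominated by a
    geometric series of ratio sin^2 x. *)
Lemma arcsin_series_cvg (x : R) : 0 < x < pi / 2 -> cvgn (arcsin_series^~ x).
Proof.
move=> /andP[x0 xpi]; have pi0 := @pi_gt0 R.
have s0 : 0 < sin x by rewrite sin_gt0_lepihalf// x0 ltW.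
have s1 : sin x < 1.
  by rewrite -sin_pihalf ltr_sin// in_itv/=; apply/andP; lra.
have C0 k := @central_bin_gt0 R k.
apply: (@series_le_cvg _ (fun k => (2 * sin x) ^+ (2 * k + 1) /
  ((2 * k + 1)%:R ^+ 2 * 'C(2 * k, k)%:R)) (geometric 2 (sin x ^+ 2))).
- by move=> k; rewrite divr_ge0 ?exprn_ge0 ?mulr_ge0 ?exprn_ge0 ?(ltW s0)// ltW.
- by move=> k; rewrite geometric_ge0 ?sqr_ge0.
- move=> k /=.
  have m0 : 1 <= (2 * k + 1)%:R :> R by rewrite ler1n addn1.
  have m0' : 0 < (2 * k + 1)%:R :> R by apply: lt_le_trans m0.
  have -> : (2 * sin x) ^+ (2 * k + 1) / ((2 * k + 1)%:R ^+ 2 * 'C(2 * k, k)%:R)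
     = 2 * (sin x ^+ 2) ^+ k * (arcsin_coef k * (sin x / (2 * k + 1)%:R)).
    rewrite addn1 exprS exprMn !exprM (_ : 2 ^+ 2 = 4 :> R); last by rewrite -natrX.
    rewrite /arcsin_coef addn1; move: m0' (C0 k); rewrite addn1.
    move: (2 * k).+1%:R 'C(_, _)%:R => m C m0' C1.
    by field; rewrite !gt_eqF.
  rewrite -[leRHS]mulr1 ler_wpM2l ?mulr_ge0 ?exprn_ge0 ?(ltW s0)//.
  rewrite mulr_ile1 ?arcsin_coef_ge0 ?arcsin_coef_le1 ?divr_ge0 ?(ltW s0)//.
  by rewrite ler_pdivrMr// mul1r (le_trans (ltW s1)).
- by apply: is_cvg_geometric_series; rewrite ger0_norm ?sqr_ge0// exprn_ilt1 ?ltW.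
Qed.

Lemma is_cvg_alternating_arcsin n m : (m <= n)%N ->
  cvgn (fun K => \sum_(0 <= i < m) (-1) ^+ i * arcsin_series K (@node R n i)).
Proof.
elim: m => [|m IH] mn.
  by under eq_fun do rewrite big_nil; exact: is_cvg_cst.
under eq_fun do rewrite big_nat_recr//=.
apply: is_cvgD; first exact: IH (ltnW mn).
exact: cvgP (cvg_scale _ _ _ (arcsin_series_cvg _ (node_bounds _ _ mn))).
Qed.

Lemma series_acceleration_cvg n : ~~ odd n -> cvgn (series (acceleration_term R n)).
Proof.
move=> en; rewrite (_ : series _ = fun K =>
  \sum_(0 <= i < n) (-1) ^+ i * arcsin_series K (@node R n i)).
  exact: is_cvg_alternating_arcsin.
by apply/funext => K; exact: series_accelerationE.
Qed.

(** The alternating sum of the defects along K = (2n+1) L has limit 0 by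
    alternating_defect_cvg0, and the limit on the left by the evaluation of its
    three parts. *)
Lemma acceleration_limit n : (0 < n)%N -> ~~ odd n ->
  limn (series (acceleration_term R n)) - pi / (2 * n + 1)%:R * ln (u R n)
   + 4 * n%:R / (2 * n + 1)%:R * catalan_constant R = 0.
Proof.
move=> n0 en; have pi0 := @pi_gt0 R.
have N0 : 0 < (2 * n + 1)%:R :> R by rewrite ltr0n addn1.
have node_mono i j : (i <= j)%N -> @node R n i <= node n j.
  by move=> ij; rewrite /node ler_pM2r ?divr_gt0 ?mulr_gt0// ler_nat; lia.
have nn : (n.-1 < n)%N by rewrite prednK.
have /andP[a0 _] := node_bounds _ _ n0.
have /andP[_ bpi] := node_bounds _ _ nn.
have N_gt0 : (0 < 2 * n + 1)%N by rewrite addn1.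
have sub := mul_cvg_oo (2 * n + 1) N_gt0.
have inodes i : (i < n)%N -> @node R n 0 <= @node R n i <= @node R n n.-1.
  by move=> iN; apply/andP; split; apply: node_mono; lia.
have T0 := cvg_comp _ _ sub
  (alternating_defect_cvg0 n (node n) _ _ en a0 bpi (node_mono _ _ (leq0n _)) inodes).
have T1 : (fun L => \sum_(0 <= i < n) (-1) ^+ i * defect ((2 * n + 1) * L) (@node R n i))
  @ \oo --> limn (series (acceleration_term R n)) - pi / (2 * n + 1)%:R * ln (u R n)
   + 4 * n%:R / (2 * n + 1)%:R * catalan_constant R.
  have h1 := cvg_comp _ _ sub (series_acceleration_cvg _ en).
  have h2 := cvg_scale (-4) _ _ (@alternating_sin_sum_cvg R n en).
  have -> : 4 * n%:R / (2 * n + 1)%:R * catalan_constant R =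
    - 4 * (- (n%:R / (2 * n + 1)%:R) * catalan_constant R) by ring.
  rewrite (_ : (fun L => _) = fun L =>
    series (acceleration_term R n) ((2 * n + 1) * L)
    - pi / (2 * n + 1)%:R * ln (u R n)
    + -4 * \sum_(0 <= i < n) (-1) ^+ i * sin_sum ((2 * n + 1) * L) (@node R n i)).
    by apply: cvgD => //; apply: cvgB => //; exact: cvg_cst.
  apply/funext => L; rewrite series_accelerationE// ln_u !big_distrr/=.
  rewrite -sumrB -big_split/=; apply: eq_bigr => i _.
  rewrite /defect (_ : 2 * node n i = (2 * i + 1)%:R * (pi / (2 * n + 1)%:R)).
    by ring.
  by rewrite /node; field; rewrite gt_eqF.
exact: cvg_unique T1 T0.
Qed.

End Assembly.

Theorem theorem8 (R : realType) (n : nat) (n_gt0 : (0 < n)%N)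
    (n_even : ~~ odd n) :
  [/\ algebraic_unit (u R n),
      cvgn (series (acceleration_term R n)) &
      catalan_constant R =
        pi / (4 * n)%:R * ln (u R n)
        - (2 * n + 1)%:R / (4 * n)%:R
          * limn (series (acceleration_term R n))].
Proof.
split; [exact: u_unit | exact: series_acceleration_cvg |].
have := @acceleration_limit R n n_gt0 n_even.
have n0 : n%:R != 0 :> R by rewrite pnatr_eq0 -lt0n.
have N0 : (2 * n + 1)%:R != 0 :> R by rewrite addn1.
rewrite natrM; move: (catalan_constant R) (limn _) (ln _) N0 => G S U.
move: (2 * n + 1)%:R => N N0 h.
have -> : S = pi / N * U - 4 * n%:R / N * G by lra.
by field; rewrite n0 N0.
Qed.
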